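(* Let $A:\mathbb{H}\rightrightarrows\mathbb{H}$ and $B:\mathbb{H}\rightrightarrows\mathbb{H}$ be respectively maximally $\alpha$- and $\beta$-monotone with $\alpha+\beta\ge0$. Suppose that $\gamma,\delta>0$ and $\lambda,\mu\ge1$ satisfy $$1+2\gamma\alpha>0,\qquad\mu\in[2-2\gamma\beta,\,2+2\gamma\alpha],\qquad(\lambda-1)(\mu-1)=1,\qquad\delta=(\lambda-1)\gamma,$$ that $\operatorname{zer}(A+B)\neq\emptyset$, and that $\inf_{t\in[t_0,+\infty)}\theta(t)>0$. Write $T:=R_{\delta B}^{\mu}R_{\gamma A}^{\lambda}$. Let $u(t)$ be the trajectory (unique strong global solution) of $$\frac{du}{dt}+\theta(t)\,[u(t)-T(u(t))]=f(t),\qquad u(t_0)=u_0\in\mathbb{H}.$$ If $$\int_{t_0}^{+\infty}\theta(s)\int_s^{+\infty}\|f(\tau)\|\,d\tau\,ds<+\infty,$$ then $\|Tu(t)-u(t)\|=O\left(\frac1{\sqrt t}\right)$ as $t\to+\infty$. In particular, if $f(t)\equiv0$, then the rate can be improved to $\|Tu(t)-u(t)\|=o\left(\frac1{\sqrt t}\right)$ as $t\to+\infty$.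
   Context: $\mathbb{H}$ is a real Hilbert space, $I$ its identity operator, $t_0>0$, $\theta:[t_0,+\infty)\to[0,+\infty)$ is locally integrable, and $f:[t_0,+\infty)\to\mathbb{H}$ belongs to $L^1([t_0,+\infty))$. A set-valued operator $A:\mathbb{H}\rightrightarrows\mathbb{H}$ is $\alpha$-monotone ($\alpha\in\mathbb{R}$) if $\langle x-y,u-v\rangle\ge\alpha\|x-y\|^2$ whenever $u\in Ax$, $v\in Ay$; it is maximally $\alpha$-monotone if moreover no $\alpha$-monotone operator has a graph strictly containing that of $A$. $J_{\gamma A}=(I+\gamma A)^{-1}$, $R_{\gamma A}^{\lambda}=(1-\lambda)I+\lambda J_{\gamma A}$, $J_{\delta B}=(I+\delta B)^{-1}$, $R_{\delta B}^{\mu}=(1-\mu)I+\mu J_{\delta B}$; under the hypotheses of the claim these are single-valued with full domain (known). $\operatorname{zer}(A+B)=\{x:0\in Ax+Bx\}$. A strong global solution is a function $u:[t_0,+\infty)\to\mathbb{H}$ that is absolutely continuous on each interval $[t_0,b]$, $t_0<b<+\infty$, satisfies the differential equation for almost every $t\ge t_0$, and satisfies $u(t_0)=u_0$; it exists and is unique here. *)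

(* Defs.v *)
From HB Require Import structures.
From mathcomp Require Export all_boot all_order all_algebra.
From mathcomp Require Export all_classical all_reals all_analysis.
From mathcomp Require Export sesquilinear.

Set Implicit Arguments.
Unset Strict Implicit.
Unset Printing Implicit Defensive.

Import Order.TTheory GRing.Theory Num.Theory.
Import numFieldNormedType.Exports.

Local Open Scope classical_set_scope.
Local Open Scope ring_scope.

(* Lets the library's [f =O_ +oo g] and [f =o_ +oo g] elaborate. *)
Canonical pinfty_filter_on (R : numFieldType) : filter_on R :=
  FilterType (pinfty_nbhs R) _.

(* A real Hilbert space is a complete normed module [H] over the reals together
   with a symmetric positive definite bilinear form [ip] inducing its norm. *)
Definition induces_norm (R : realType) (H : completeNormedModType R)
    (ip : {dot H for idfun}) : Prop :=
  forall x : H, `|x| = Num.sqrt (ip x x).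

Section set_valued_operators.
Variables (R : realType) (H : completeNormedModType R).
Implicit Types (A B : H -> set H) (x : H).

Definition gra A : set (H * H) := [set p | A p.1 p.2].

Definition op_id : H -> set H := fun x => [set x].

Definition op_add A B : H -> set H :=
  fun x => [set a + b | a in A x & b in B x].

Definition op_scale (g : R) A : H -> set H := fun x => [set g *: a | a in A x].

Definition op_inv A : H -> set H := fun y => [set x | A x y].

Definition zer A : set H := [set x | A x 0].

Definition alpha_monotone (ip : {dot H for idfun}) (alpha : R) A : Prop :=
  forall x y u v, A x u -> A y v -> alpha * `|x - y| ^+ 2 <= ip (x - y) (u - v).

Definition maximally_alpha_monotone (ip : {dot H for idfun}) (alpha : R) A
    : Prop :=
  alpha_monotone ip alpha A /\
  ~ exists A', alpha_monotone ip alpha A' /\ gra A `<` gra A'.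

(* [(I + g A)^-1] as a function: its value at [x] is the element of the set
   [op_inv (op_add op_id (op_scale g A)) x], which is a singleton whenever the
   resolvent is single-valued with full domain ([xget] returns the default [0]
   on an empty set). *)
Definition resolvent (g : R) A : H -> H :=
  fun x => xget 0 (op_inv (op_add op_id (op_scale g A)) x).

Definition relaxed_resolvent (g lambda : R) A : H -> H :=
  fun x => (1 - lambda) *: x + lambda *: resolvent g A x.

End set_valued_operators.

(* The measurable sets of [lebesgue_measure] are the Borel sets; Lebesgue
   measurability is therefore expressed by almost everywhere equality with a
   Borel function, or almost everywhere convergence of Borel simple functions.
   The library integral of a nonnegative function is the supremum of the
   integrals of the Borel simple functions below it, which is the Lebesgue
   integral for every Lebesgue measurable function. *)
Section functions_of_time.
Variable R : realType.
Local Notation leb := (@lebesgue_measure R).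

(* The library's [locally_integrable] requires an open domain. *)
Definition locally_integrable_on (D : set R) (th : R -> R) : Prop :=
  exists th' : R -> R, {ae leb, forall t, D t -> th t = th' t} /\
    forall K : set R, K `<=` D -> compact K -> leb.-integrable K (EFin \o th').

Variable H : completeNormedModType R.

Definition strongly_measurable (D : set R) (f : R -> H) : Prop :=
  exists s : nat -> {fimfun R >-> H},
    (forall n y, measurable (s n @^-1` [set y])) /\
    {ae leb, forall t, D t -> s n t @[n --> \oo] --> f t}.

Definition bochner_L1 (D : set R) (f : R -> H) : Prop :=
  strongly_measurable D f /\
  (\int[leb]_(t in D) `|f t|%:E < +oo)%E.

Definition absolutely_continuous_on (a b : R) (u : R -> H) : Prop :=
  forall e : R, 0 < e -> exists2 d : R, 0 < d &
    forall (n : nat) (p q : 'I_n -> R),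
      (forall i, a <= p i /\ p i < q i /\ q i <= b) ->
      trivIset setT (fun i => `]p i, q i[%classic) ->
      \sum_(i < n) (q i - p i) < d ->
      \sum_(i < n) `|u (q i) - u (p i)| < e.

(* The values of [u] on ]-oo, t0[ are irrelevant: only those [t > t0] matter in
   the almost everywhere condition. *)
Definition strong_global_solution (t0 : R) (theta : R -> R) (T : H -> H)
    (f : R -> H) (u0 : H) (u : R -> H) : Prop :=
  [/\ forall b, t0 < b -> absolutely_continuous_on t0 b u,
      {ae leb, forall t, t0 <= t -> derivable (u : R^o -> H) t 1 /\
        derive1 (u : R^o -> H) t + theta t *: (u t - T (u t)) = f t}
    & u t0 = u0].

End functions_of_time.

(* Main.v *)
Require Import Defs.
From mathcomp Require Import measurable_realfun ring lra.
Import Order.TTheory GRing.Theory Num.Theory.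
Import numFieldNormedType.Exports.
Local Open Scope classical_set_scope.
Local Open Scope ring_scope.

Set Implicit Arguments.
Unset Strict Implicit.
Unset Printing Implicit Defensive.

(* By Minty's theorem both resolvents are everywhere defined, and monotonicity
   makes R_A (lambda - 1)-Lipschitz and R_B (mu - 1)-Lipschitz; as
   (lambda - 1)(mu - 1) = 1, T is nonexpansive.  A zero z of A + B with a in A z
   gives the fixed point p = z + gamma a.
   Along the trajectory, nonexpansiveness bounds the slopes of |u - p|,
   |Tu - u| and |u - p|^2 by |f|, 2|f| and 2|f||u - p| - theta |Tu - u|^2 almost
   everywhere.  Correcting by the tail F(t) of the integral of |f|, the residual
   |Tu - u| + 2F is nonincreasing, so the dissipation of |u - p|^2 on [s, t]
   dominates (t - s)|Tu(t) - u(t)|^2.  Taking s = t0 gives O; when f = 0,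
   taking s = t / 2 and using that |u - p|^2 converges gives o. *)

(** * Inner products and Minty's theorem *)

(** [T] is only Lipschitz and a norm is not differentiable at 0, so the residual and the distance to
    [p] need not be differentiable where [u] is. Hence only upper bounds on difference quotients
    over intervals straddling a point are used, obtained from an explicit Euler step. They integrate
    because an absolutely continuous function with nonpositive slope almost everywhere is
    nonincreasing. The weighted integral hypothesis enters through [theta >= c]: it makes the tail
    [F] integrable on the half-line, and the primitive [K] of [F] pays for the error of order
    [F ^+ 2] made when the residual is replaced by the residual plus [2 * F]. *)

Section inner_product.
Variables (R : realType) (H : completeNormedModType R) (ip : {dot H for idfun}).
Hypothesis ip_norm : induces_norm ip.
Implicit Types (x y z : H) (a : R).

Lemma ipDl x y z : ip (x + y) z = ip x z + ip y z.
Proof. exact: linearDl. Qed.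

Lemma ipBl x y z : ip (x - y) z = ip x z - ip y z.
Proof. exact: linearBl. Qed.

Lemma ipNl x z : ip (- x) z = - ip x z.
Proof. exact: linearNl. Qed.

Lemma ipZl a x z : ip (a *: x) z = a * ip x z.
Proof. exact: linearZl_LR. Qed.

Lemma ipC x y : ip x y = ip y x.
Proof. by rewrite hermitian_subproof expr0 mul1r. Qed.

Lemma ipDr x y z : ip z (x + y) = ip z x + ip z y.
Proof. exact: linearDr. Qed.

Lemma ipBr x y z : ip z (x - y) = ip z x - ip z y.
Proof. exact: linearBr. Qed.

Lemma ipNr x z : ip z (- x) = - ip z x.
Proof. exact: linearNr. Qed.

Lemma ipZr a x z : ip z (a *: x) = a * ip z x.
Proof. by rewrite ipC ipZl ipC. Qed.

Lemma ip0l x : ip 0 x = 0.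
Proof. exact: linear0l. Qed.

Lemma ip0r x : ip x 0 = 0.
Proof. exact: linear0r. Qed.

Definition ip_linear := (ipDl, ipBl, ipNl, ipZl, ipDr, ipBr, ipNr, ipZr).

Lemma ip_ge0 x : 0 <= ip x x.
Proof.
have [->|x0] := eqVneq x 0; last exact/ltW/neq0_dnorm_gt0.
by rewrite ip0l.
Qed.

Lemma ip_self x : ip x x = `|x| ^+ 2.
Proof. by rewrite ip_norm sqr_sqrtr// ip_ge0. Qed.

Lemma ip_inj x y : (forall z, ip x z = ip y z) -> x = y.
Proof.
move=> xy; apply/eqP; rewrite -subr_eq0 -normr_eq0 -sqrf_eq0 -ip_self.
by rewrite ipBl xy subrr.
Qed.

Lemma cauchy_schwarz x y : ip x y <= `|x| * `|y|.
Proof.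
have [->|x0] := eqVneq x 0.
  by rewrite ip0l normr0 mul0r.
have [->|y0] := eqVneq y 0.
  by rewrite ip0r normr0 mulr0.
have X0 : 0 < `|x| by rewrite normr_gt0.
have Y0 : 0 < `|y| by rewrite normr_gt0.
have := ip_ge0 (`|y| *: x - `|x| *: y).
rewrite !ip_linear (ipC y x) !ip_self => h.
have : 0 < `|x| * `|y| by exact: mulr_gt0.
nra.
Qed.

End inner_product.

(** Pairing with an arbitrary vector turns a vector identity into a scalar one for [ring]. *)
Ltac vec_eq ip_norm := apply: (ip_inj ip_norm) => ?; rewrite !ip_linear; ring.

Section minty.
Variables (R : realType) (H : completeNormedModType R) (ip : {dot H for idfun}).
Hypothesis ip_norm : induces_norm ip.
Implicit Types (x y : H).

(** The bound has the form that the parallelogram identity gives for a minimising sequence. *)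
Lemma cauchy_seq_cvg (x : nat -> H) (C : R) :
  (forall n k, `|x n - x k| ^+ 2 <= C * (n.+1%:R^-1 + k.+1%:R^-1)) ->
  exists l : H, x @ \oo --> l.
Proof.
move=> xC.
have C0 : 0 <= C.
  have := xC 0%N 0%N; rewrite subrr normr0 expr0n /= invr1; lra.
suff : cvgn x by move=> /cvg_ex[l xl]; exists l.
apply/cauchy_cvgP/cauchy_ballP => e e0.
have d0 : 0 < e ^+ 2 / (2 * C + 1) by rewrite divr_gt0 ?exprn_gt0//; lra.
have [N _ hN] := near_infty_natSinv_lt (PosNum d0).
exists (x @` [set n | (N <= n)%N], x @` [set n | (N <= n)%N]) => /=.
  by split; exists N => // n Nn; exists n.
move=> [_ _] /= [[n Nn <-] [k Nk <-]].
rewrite -ball_normE /ball_/= -(@ltr_pXn2r _ 2)// ?nnegrE// ?ltW//.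
apply: le_lt_trans (xC n k) _.
have /= := hN n Nn; have /= := hN k Nk.
rewrite !ltr_pdivlMr; last lra; last lra.
set p := n.+1%:R^-1; set q := k.+1%:R^-1 => h1 h2.
have p0 : 0 < p by rewrite invr_gt0.
have q0 : 0 < q by rewrite invr_gt0.
nra.
Qed.

Lemma cvg_ipl (x : nat -> H) (l y : H) :
  x @ \oo --> l -> ip (x n) y @[n --> \oo] --> ip l y.
Proof.
move=> xl; apply/cvgrPdist_le => e e0.
have d0 : 0 < e / (`|y| + 1) by rewrite divr_gt0// ltr_wpDl.
move/cvgrPdist_le : xl => /(_ _ d0); apply: filterS => n.
rewrite ler_pdivlMr ?ltr_wpDl// => h.
have := normr_ge0 (l - x n) => n0.
rewrite -(ipBl ip) ler_norml; apply/andP; split; last first.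
  apply: le_trans (cauchy_schwarz ip_norm _ _) _; nra.
rewrite lerNl -(ipNl ip) .
apply: le_trans (cauchy_schwarz ip_norm _ _) _; rewrite normrN; nra.
Qed.

(* Minimise [F(x, s) + (|x|^2 + |s|^2) / 2], where [F] is the Fitzpatrick
   function of [G]: maximality gives [F(x, s) >= <x, s>], so the minimum is
   nonnegative, and the optimality condition at the minimiser [(x, s)] says that
   [(-s, -x)] is monotonically related to [G].  The triples below are the
   points of the epigraph of [F]. *)
Lemma minty (G : H -> set H) :
  (forall x y u v, G x u -> G y v -> 0 <= ip (x - y) (u - v)) ->
  (forall x u, (forall y v, G y v -> 0 <= ip (x - y) (u - v)) -> G x u) ->
  exists x, G x (- x).
Proof.
move=> mono maxi.
(* If [G] were empty, its maximality would vacuously put [(0, 0)] in it. *)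
have [y0 [v0 G0]] : exists y v, G y v.
  apply: contrapT => nG; apply: (nG); exists 0, 0; apply: maxi => y v Gyv.
  by exfalso; apply: nG; exists y, v.
pose epi (x s : H) (r : R) := forall a b, G a b -> ip x b + ip a s - ip a b <= r.
pose q (x s : H) (r : R) := r + (`|x| ^+ 2 + `|s| ^+ 2) / 2.
(* On [G], test the epigraph with the pair itself; off [G], with a pair that violates
   monotonicity. *)
have epi_ge x s r : epi x s r -> ip x s <= r.
  move=> exs; have [Gxs|nG] := pselect (G x s).
    by have := exs _ _ Gxs; lra.
  have /existsNP[a /existsNP[b /not_implyP[Gab /negP]]] :
    ~ forall y v, G y v -> 0 <= ip (x - y) (s - v) by move=> /maxi.
  rewrite -ltNge !ip_linear; have := exs _ _ Gab; lra.
have sq_add x s : `|x + s| ^+ 2 = `|x| ^+ 2 + `|s| ^+ 2 + 2 * ip x s.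
  by rewrite -!(ip_self ip_norm) !ip_linear (ipC ip s x); ring.
have q_ge0 x s r : epi x s r -> 0 <= q x s r.
  move=> /epi_ge; rewrite /q; have := sq_add x s.
  have := sqr_ge0 `|x + s|; lra.
have epiG y v : G y v -> epi y v (ip y v).
  move=> Gyv a b Gab; have := mono _ _ _ _ Gyv Gab; rewrite !ip_linear; lra.
pose Q := [set z | exists x s r, epi x s r /\ z = q x s r].
have Q0 : Q !=set0.
  by exists (q y0 v0 (ip y0 v0)), y0, v0, (ip y0 v0); split=> //; exact: epiG.
have Qlb : has_lbound Q by exists 0 => _ [x [s [r [e ->]]]]; exact: q_ge0.
pose m := inf Q.
have m_le x s r : epi x s r -> m <= q x s r.
  by move=> e; apply: ge_inf => //; exists x, s, r.
have conv x s r y v p t : 0 <= t -> t <= 1 -> epi x s r -> epi y v p ->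
  epi (x + t *: (y - x)) (s + t *: (v - s)) (r + t * (p - r)).
  move=> t0 t1 e1 e2 a b Gab; rewrite !ip_linear.
  have := e1 _ _ Gab; have := e2 _ _ Gab; nra.
have seqex n : exists z : H * H * R, epi z.1.1 z.1.2 z.2 /\
    q z.1.1 z.1.2 z.2 < m + n.+1%:R^-1.
  have n0 : 0 < n.+1%:R^-1 :> R by rewrite invr_gt0.
  have [_ [x [s [r [e ->]]]] lt] := inf_adherent n0 (conj Q0 Qlb).
  by exists (x, s, r).
have [z zP] := choice seqex.
(* The midpoint of two near-minimisers has value at least [m], while the parallelogram identity puts
   it below their mean value by an eighth of the left-hand side. *)
have close n k : `|(z n).1.1 - (z k).1.1| ^+ 2 + `|(z n).1.2 - (z k).1.2| ^+ 2 <=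
    4 * (n.+1%:R^-1 + k.+1%:R^-1).
  have [e1 l1] := zP n; have [e2 l2] := zP k.
  have h0 : 0 <= 2^-1 :> R by lra.
  have h1 : 2^-1 <= 1 :> R by lra.
  have := m_le _ _ _ (conv _ _ _ _ _ _ _ h0 h1 e1 e2).
  move: l1 l2; rewrite /q -!(ip_self ip_norm) !ip_linear.
  rewrite (ipC ip (z k).1.1 (z n).1.1) (ipC ip (z k).1.2 (z n).1.2).
  by move: (n.+1%:R^-1) (k.+1%:R^-1) => p p'; lra.
have [x zx] : exists l : H, (fun n => (z n).1.1) @ \oo --> l.
  apply: (@cauchy_seq_cvg _ 4) => n k; have := close n k.
  have := sqr_ge0 `|(z n).1.2 - (z k).1.2|.
  by move: (n.+1%:R^-1) (k.+1%:R^-1) => p p'; lra.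
have [s zs] : exists l : H, (fun n => (z n).1.2) @ \oo --> l.
  apply: (@cauchy_seq_cvg _ 4) => n k; have := close n k.
  have := sqr_ge0 `|(z n).1.1 - (z k).1.1|.
  by move: (n.+1%:R^-1) (k.+1%:R^-1) => p p'; lra.
(* This makes [q x s r] equal to [m]. The inequalities defining the epigraph are affine in the
   point, so they pass to the limit. *)
pose r := m - (`|x| ^+ 2 + `|s| ^+ 2) / 2.
have exs : epi x s r.
  move=> a b Gab.
  have cvL : ip (z n).1.1 b + ip (z n).1.2 a - ip a b @[n --> \oo] -->
             ip x b + ip s a - ip a b.
    by apply: cvgB; [apply: cvgD; exact: cvg_ipl|exact: cvg_cst].
  have cvR : (m + n.+1%:R^-1) - (`|(z n).1.1| ^+ 2 + `|(z n).1.2| ^+ 2) * 2^-1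
      @[n --> \oo] --> (m + 0) - (`|x| ^+ 2 + `|s| ^+ 2) * 2^-1.
    apply: cvgB; first by apply: cvgD; [exact: cvg_cst|exact: cvg_harmonic].
    apply: cvgM; last exact: cvg_cst.
    by rewrite !expr2; apply: cvgD; apply: cvgM; exact: cvg_norm.
  rewrite /r (ipC ip a s) -(addr0 m).
  apply: (ler_cvg_to cvL cvR); apply: nearW => n.
  have [en ln] := zP n; have := en _ _ Gab; rewrite (ipC ip a) /q in ln *.
  by move: (n.+1%:R^-1) ln => p ln; lra.
have qm : q x s r = m by rewrite /q /r; lra.
(* First variation: a move by the fraction [t] towards [(y, v)] cannot lower [q]. After division by
   [t] the remainder is [t * N / 2], which the choice of [t] keeps below [e]. *)
have opt y v : G y v -> r <= ip y v + ip x (y - x) + ip s (v - s).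
  move=> Gyv; apply/ler_addgt0Pr => e e0.
  pose N := `|y - x| ^+ 2 + `|v - s| ^+ 2.
  have N0 : 0 <= N by rewrite addr_ge0// sqr_ge0.
  pose t := Num.min 1 (e / (N + 1)).
  have t0 : 0 < t by rewrite lt_min ltr01 divr_gt0//; lra.
  have t1 : t <= 1 by rewrite ge_min lexx.
  have tN : t * (N + 1) <= e by rewrite -ler_pdivlMr ?ge_min ?lexx ?orbT//; lra.
  clearbody t.
  have := m_le _ _ _ (conv _ _ _ _ _ _ _ (ltW t0) t1 exs (epiG _ _ Gyv)).
  rewrite -qm /q.
  have sqE x' y' : `|x' + t *: y'| ^+ 2 =
      `|x'| ^+ 2 + t * (2 * ip x' y' + t * `|y'| ^+ 2).
    rewrite -!(ip_self ip_norm) !ip_linear (ipC ip y' x'); ring.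
  rewrite !sqE => h.
  have : 0 <= t * (ip y v - r + ip x (y - x) + ip s (v - s) + t * N / 2).
    by move: h; rewrite /N; lra.
  clearbody N.
  have tN2 : t * N / 2 <= e.
    have := mulr_ge0 (ltW t0) N0; rewrite mulrDr mulr1 in tN; lra.
  rewrite pmulr_rge0//; lra.
have key y v : G y v -> `|x + s| ^+ 2 <= ip (- s - y) (- x - v).
  move=> /opt; have := epi_ge _ _ _ exs.
  rewrite sq_add -!(ip_self ip_norm) !ip_linear (ipC ip s x) (ipC ip y x); lra.
have Gsx : G (- s) (- x).
  by apply: maxi => y v /key; apply: le_trans; exact: sqr_ge0.
(* Now [(- s, - x)] itself may serve as [(y, v)] in [key], where the right-hand side vanishes. *)
have : x + s = 0.
  apply/eqP; rewrite -normr_eq0 -sqrf_eq0 eq_le sqr_ge0 andbT.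
  apply: le_trans (key _ _ Gsx) _.
  by rewrite !subrr ip0l.
by move=> /eqP; rewrite addrC addr_eq0 => /eqP sx; exists x; rewrite sx opprK in Gsx.
Qed.

End minty.

(** * Relaxed resolvents *)

Section resolvents.
Variables (R : realType) (H : completeNormedModType R) (ip : {dot H for idfun}).
Hypothesis ip_norm : induces_norm ip.
Implicit Types (A : H -> set H) (x y w : H).

(** Adjoining [(x, u)] to the graph keeps it [alpha]-monotone, so maximality forces the pair to be
    there already. *)
Lemma maximal_mem alpha A x u : maximally_alpha_monotone ip alpha A ->
  (forall y v, A y v -> alpha * `|x - y| ^+ 2 <= ip (x - y) (u - v)) -> A x u.
Proof.
move=> [Amono Amax] xuA; apply: contrapT => nAxu; apply: Amax.
exists (fun y => A y `|` [set v | y = x /\ v = u]); split.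
  move=> y z v w [Ayv|[-> ->]] [Azw|[-> ->]].
  - exact: Amono.
  - by rewrite -(opprB x) -(opprB u) normrN (ipNl ip) (ipNr ip) opprK; exact: xuA.
  - exact: xuA.
  - by rewrite !subrr normr0 expr0n/= mulr0 (ip0l ip).
rewrite properEneq; split; last by move=> [y v] /= ?; left.
apply/eqP => E; apply: nAxu.
by have : gra A (x, u) by rewrite E; right.
Qed.

(** The operator [g A - g alpha I] is monotone; an affine change of the second coordinate, scaled by
    [1 + g * alpha > 0], turns [A] into a maximally monotone graph to which [minty] applies. *)
Lemma resolvent_surj alpha g A : maximally_alpha_monotone ip alpha A ->
  0 < g -> 0 < 1 + g * alpha -> forall w, exists x a, A x a /\ x + g *: a = w.
Proof.
move=> Amax g0 ga0 w; have [Amono _] := Amax.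
have g_neq0 : g != 0 by rewrite gt_eqF.
have ga_neq0 : 1 + g * alpha != 0 by rewrite gt_eqF.
(* [(x, s)] encodes the pair [(x, val x s)] of the graph of [A], so that [s = - x]
   means [x + g *: val x s = w]. *)
pose val x s := g^-1 *: ((1 + g * alpha) *: s + w + (g * alpha) *: x).
have valB x y s r : ip (x - y) (val x s - val y r) =
    g^-1 * (1 + g * alpha) * ip (x - y) (s - r) + alpha * `|x - y| ^+ 2.
  by rewrite /val -(ip_self ip_norm) !ip_linear (ipC ip y x); field.
have c0 : 0 < g^-1 * (1 + g * alpha) by rewrite mulr_gt0 ?invr_gt0.
have [|x s xsG|x] := @minty _ _ _ ip_norm (fun x s => A x (val x s)).
- move=> x y s r /Amono h /h; rewrite valB lerDr pmulr_rge0//.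
- apply: (maximal_mem Amax) => y b Ayb.
  pose r := (1 + g * alpha)^-1 *: (g *: b - (g * alpha) *: y - w).
  have rE : val y r = b.
    rewrite /val /r; apply: (ip_inj ip_norm) => ?; rewrite !ip_linear; field.
    by rewrite ga_neq0.
  by rewrite -rE valB lerDr pmulr_rge0//; apply: xsG; rewrite rE.
- move=> Gx; exists x, (val x (- x)); split=> //.
  by rewrite /val; apply: (ip_inj ip_norm) => ?; rewrite !ip_linear; field.
Qed.

Lemma resolventP alpha g A : maximally_alpha_monotone ip alpha A ->
  0 < g -> 0 < 1 + g * alpha ->
  forall w, exists a, A (resolvent g A w) a /\ resolvent g A w + g *: a = w.
Proof.
move=> Amax g0 ga0 w; have [x [a [Axa xaw]]] := resolvent_surj Amax g0 ga0 w.
have : op_inv (op_add (@op_id R H) (op_scale g A)) w x.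
  by exists x => //; exists (g *: a) => //; exists a.
by move=> /(xgetI 0) -[_ /= -> [_ [b Ab <-] E]]; exists b.
Qed.

(** Two solutions [x], [y] of the resolvent inclusion satisfy [(1 + g * alpha) * |y - x|^2 <= 0], so
    the value picked by [xget] is forced. *)
Lemma resolvent_id alpha g A x a : maximally_alpha_monotone ip alpha A ->
  0 < g -> 0 < 1 + g * alpha -> A x a -> resolvent g A (x + g *: a) = x.
Proof.
move=> Amax g0 ga0 Axa; have [b [Ab]] := resolventP Amax g0 ga0 (x + g *: a).
move: (resolvent g A (x + g *: a)) Ab => y Ayb E.
have [Amono _] := Amax; have := Amono _ _ _ _ Ayb Axa.
have Eba : g *: (b - a) = x - y.
  have -> : g *: (b - a) = y + g *: b - y - g *: a by vec_eq ip_norm.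
  by rewrite E; vec_eq ip_norm.
rewrite -(ler_pM2l g0) -(ipZr ip) Eba -(opprB y) (ipNr ip) (ip_self ip_norm) => h.
have : (1 + g * alpha) * `|y - x| ^+ 2 <= 0 by lra.
rewrite pmulr_rle0// => h0.
by apply/eqP; rewrite -subr_eq0 -normr_eq0 -sqrf_eq0 eq_le h0 sqr_ge0.
Qed.

Lemma relaxed_resolvent_lip alpha g lambda A :
  maximally_alpha_monotone ip alpha A -> 0 < g -> 0 < 1 + g * alpha ->
  1 <= lambda -> lambda <= (lambda - 1) * (2 + 2 * g * alpha) ->
  forall x y, `|relaxed_resolvent g lambda A x - relaxed_resolvent g lambda A y| <=
    (lambda - 1) * `|x - y|.
Proof.
move=> Amax g0 ga0 l1 hl x y; rewrite /relaxed_resolvent.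
have [a [Aa]] := resolventP Amax g0 ga0 x.
have [b [Ab]] := resolventP Amax g0 ga0 y.
move: (resolvent g A x) (resolvent g A y) Aa Ab => p q Aa Ab <- <-.
have [Amono _] := Amax; have := Amono _ _ _ _ Aa Ab.
rewrite -(ler_pM2l g0) -(ipZr ip).
pose e := p - q; pose c := g *: (a - b).
have -> : (1 - lambda) *: (p + g *: a) + lambda *: p -
    ((1 - lambda) *: (q + g *: b) + lambda *: q) = e + (1 - lambda) *: c.
  by rewrite /e /c; vec_eq ip_norm.
have -> : p + g *: a - (q + g *: b) = e + c by rewrite /e /c; vec_eq ip_norm.
rewrite -/e -/c -!(ip_self ip_norm); clearbody e c => h.
have l1' : 0 <= lambda - 1 by lra.
rewrite -(@ler_pXn2r _ 2)// ?nnegrE ?mulr_ge0//.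
rewrite exprMn -!(ip_self ip_norm) !ip_linear (ipC ip c e).
have E0 := ip_ge0 ip e.
(* The difference of the two squares equals twice the quantity in [h1] plus the one in [h2]:
   monotonicity signs the first, the bound on [lambda] the second. *)
have h1 : 0 <= (lambda - 1) * lambda * (ip e c - g * (alpha * ip e e)).
  by rewrite !mulr_ge0//; lra.
have h2 : 0 <= lambda * ip e e * ((lambda - 1) * (2 + 2 * g * alpha) - lambda).
  by rewrite !mulr_ge0//; lra.
move: (ip e e) (ip e c) (ip c c) h1 h2 => ee ec cc h1 h2.
lra.
Qed.

End resolvents.

(** * Nonexpansiveness and a fixed point of the composition *)

Section douglas_rachford.
Variables (R : realType) (H : completeNormedModType R) (ip : {dot H for idfun}).
Hypothesis ip_norm : induces_norm ip.
Variables (A B : H -> set H) (alpha beta gamma delta lambda mu : R).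
Hypotheses (A_max : maximally_alpha_monotone ip alpha A)
  (B_max : maximally_alpha_monotone ip beta B)
  (gamma_gt0 : 0 < gamma) (delta_gt0 : 0 < delta)
  (lambda_ge1 : 1 <= lambda) (mu_ge1 : 1 <= mu)
  (gammaalpha : 0 < 1 + 2 * gamma * alpha)
  (mu_in : mu \in `[2 - 2 * gamma * beta, 2 + 2 * gamma * alpha])
  (lambdamu : (lambda - 1) * (mu - 1) = 1)
  (deltaE : delta = (lambda - 1) * gamma).

Let T := relaxed_resolvent delta mu B \o relaxed_resolvent gamma lambda A.

(** With [deltaE], this makes the roles of [(A, gamma, lambda)] and [(B, delta, mu)] symmetric. *)
Let deltamu : (mu - 1) * delta = gamma.
Proof. by rewrite deltaE mulrA (mulrC (mu - 1)) lambdamu mul1r. Qed.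

Let gammaalpha1 : 0 < 1 + gamma * alpha.
Proof. by move: gammaalpha => h; lra. Qed.

Let deltabeta1 : 0 < 1 + delta * beta.
Proof.
move: mu_in; rewrite in_itv/= => /andP[+ _]; rewrite -deltamu => h.
have mu1 : 0 < mu - 1.
  rewrite lt_neqAle subr_ge0 mu_ge1 andbT eq_sym; apply/eqP => E.
  by move: lambdamu; rewrite E mulr0 => /eqP; rewrite eq_sym oner_eq0.
rewrite -(pmulr_rgt0 _ mu1); lra.
Qed.

(** Since [(lambda - 1) * mu = lambda], the upper end of the interval for [mu] is the Lipschitz
    condition for the factor of [A]; the lower end, rewritten with [deltamu], is the one for [B]. *)
Lemma douglas_rachford_nonexpansive x y : `|T x - T y| <= `|x - y|.
Proof.
move: mu_in lambda_ge1 mu_ge1 lambdamu.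
rewrite in_itv/= => /andP[mu_ge mu_le] l1 m1 lm.
have lA : lambda <= (lambda - 1) * (2 + 2 * gamma * alpha).
  have : 0 <= (lambda - 1) * (2 + 2 * gamma * alpha - mu) by rewrite mulr_ge0//; lra.
  lra.
have lB : mu <= (mu - 1) * (2 + 2 * delta * beta).
  by rewrite -deltamu in mu_ge; lra.
apply: le_trans (relaxed_resolvent_lip ip_norm B_max delta_gt0 _ mu_ge1 lB _ _) _ => //.
have := relaxed_resolvent_lip ip_norm A_max gamma_gt0 gammaalpha1 lambda_ge1 lA x y.
have mu1 : 0 <= mu - 1 by lra.
move=> /(ler_wpM2l mu1) /le_trans; apply.
by rewrite mulrA (mulrC (mu - 1)) lambdamu mul1r.
Qed.

(** With [b = - a] in [B z], the first factor sends [z + gamma a] to [z + delta b], and the second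
    sends that to [z - gamma b], which is the starting point. *)
Lemma douglas_rachford_fixpoint : zer (op_add A B) !=set0 -> exists p, T p = p.
Proof.
move=> [z [a Aza [b Bzb /eqP]]]; rewrite addr_eq0 => /eqP abE.
exists (z + gamma *: a); rewrite /T /= /relaxed_resolvent.
rewrite (resolvent_id ip_norm A_max)//.
have -> : (1 - lambda) *: (z + gamma *: a) + lambda *: z = z + delta *: b.
  by rewrite deltaE abE; vec_eq ip_norm.
rewrite (resolvent_id ip_norm B_max)//.
have -> : gamma *: a = - (gamma *: b) by rewrite abE scalerN.
by rewrite -deltamu; vec_eq ip_norm.
Qed.

End douglas_rachford.

(** * Absolutely continuous functions with nonpositive slope *)

Section monotonicity.
Variable R : realType.
Implicit Types (a b t k : R) (psi : R -> R).
Local Notation leb := (@lebesgue_measure R).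
Local Notation ac a b psi := (@absolutely_continuous_on R R^o a b psi).

(** An upper derivative over intervals straddling [t]: it needs no differentiability, adds up, and
    provides the steps that [real_induction] takes across [t]. *)
Definition slope_le psi k t := forall e, 0 < e -> exists2 d, 0 < d &
  forall s1 s2, s1 <= t -> t <= s2 -> s2 - s1 < d ->
    psi s2 - psi s1 <= (k + e) * (s2 - s1).

Lemma ae_lebesgueS (P Q : R -> Prop) : (forall t, P t -> Q t) ->
  {ae leb, forall t, P t} -> {ae leb, forall t, Q t}.
Proof. exact: (@filterS _ _ (ae_filter_ringOfSetsType leb)). Qed.

Lemma ae_lebesgueI (P Q : R -> Prop) : {ae leb, forall t, P t} ->
  {ae leb, forall t, Q t} -> {ae leb, forall t, P t /\ Q t}.
Proof. exact: (@filterI _ _ (ae_filter_ringOfSetsType leb)). Qed.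

Lemma null_cover (N : set R) d : leb.-negligible N -> 0 < d ->
  exists U : set R, [/\ open U, N `<=` U & (leb U < d%:E)%E].
Proof.
move=> [A [mA A0 NA]] d0.
have Afin : (leb A < +oo)%E by rewrite A0.
have [U [oU AU Ud]] := lebesgue_regularity_outer mA Afin d0.
exists U; split=> //; first exact: subset_trans NA AU.
have mU : measurable U by exact: open_measurable.
rewrite -(setDUK AU) setUC measureU0//.
exact: measurableD.
Qed.

Lemma sum_itv_le (U : set R) n (p q : nat -> R) : measurable U ->
  (forall i, (i < n)%N -> p i < q i /\ `]p i, q i[ `<=` U) ->
  trivIset [set: 'I_n] (fun i : 'I_n => `]p i, q i[%classic) ->
  ((\sum_(i < n) (q i - p i))%:E <= leb U)%E.
Proof.
move=> mU pq tr.
have -> : ((\sum_(i < n) (q i - p i))%:E = \sum_(i < n) leb `]p i, q i[%classic)%E.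
  rewrite -sumEFin; apply: eq_bigr => i _.
  have [h _] := pq i (ltn_ord i).
  by rewrite lebesgue_measure_itv /= lte_fin h EFinB.
have mB : measurable (\big[setU/set0]_(i < n) `]p i, q i[%classic).
  by apply: bigsetU_measurable => i _; exact: measurable_itv.
rewrite -measure_semi_additive_ord//.
apply: le_measure; rewrite ?inE//.
rewrite -(bigcup_mkord n (fun i => `]p i, q i[%classic)) => x [i /= lt_in].
exact: (pq i lt_in).2.
Qed.

(** From a good point just below the supremum of the good points, one admissible step leads beyond
    it, unless the supremum is [b]. *)
Lemma real_induction a b (step : R -> R -> Prop) (good : R -> Prop) :
  a <= b -> good a ->
  (forall x y, a <= x -> y <= b -> x < y -> good x -> step x y -> good y) ->
  (forall t, a <= t <= b -> exists2 r, 0 < r & forall s1 s2,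
    a <= s1 -> s1 <= t -> t <= s2 -> s2 <= b -> s2 - s1 < r -> step s1 s2) ->
  good b.
Proof.
move=> ab ga gstep loc.
pose S := [set x | a <= x <= b /\ good x].
have Sa : S a by split; rewrite // lexx.
have supS : has_sup S.
  by split; [exists a|exists b => x [/andP[]]].
pose s := sup S.
have le_s x : S x -> x <= s by exact: sup_upper_bound.
have as_ : a <= s by exact: le_s.
have sb : s <= b by apply: ge_sup; [exists a|move=> x [/andP[]]].
have [|r r0 hr] := loc s; first by rewrite as_ sb.
have r4 : 0 < r / 4 by rewrite divr_gt0.
have [x Sx sx] := sup_adherent r4 supS.
have xs := le_s x Sx.
have [/andP[ax xb] gx] := Sx.
pose y := Num.min b (s + r / 4).
have yb : y <= b by rewrite ge_min lexx.
have sy : s <= y by rewrite le_min sb lerDl ltW.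
have yr : y <= s + r / 4 by rewrite ge_min lexx orbT.
have gy : good y.
  have [xy|yx] := ltP x y; last by have -> : y = x by lra.
  apply: (gstep x y) => //; apply: hr => //; rewrite -/s in sx; lra.
have : y <= s by apply: le_s; split => //; rewrite yb (le_trans as_).
by rewrite /y ge_min => /orP[bs|]; [rewrite (_ : b = y)//; lra|lra].
Qed.

(* Cover the exceptional null set by an open set so small that, by absolute
   continuity, the variation of psi over it is at most e; outside of it psi grows
   with slope at most e. *)
Lemma ac_slope_le0 a b psi : a <= b -> ac a b psi ->
  {ae leb, forall t, a < t < b -> slope_le psi 0 t} -> psi b <= psi a.
Proof.
move=> ab acp slp; apply/ler_addgt0Pr => e' e'0.
(* The part [e * (b - a)] pays for the slope, the other [e] for the variation over the cover; the
   [+ 1] allows [a = b]. *)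
pose e := e' / (b - a + 1).
have e0 : 0 < e by rewrite divr_gt0//; lra.
have -> : e' = e * (b - a) + e by rewrite /e; field; rewrite gt_eqF//; lra.
have [d d0 hd] := acp e e0.
have : leb.-negligible ((~` [set t | a < t < b -> slope_le psi 0 t]) `|`
    ([set a] `|` [set b])).
  apply: negligibleU => //; apply: negligibleU.
    by apply/negligibleP => //; exact: lebesgue_measure_set1.
  by apply/negligibleP => //; exact: lebesgue_measure_set1.
move=> /null_cover /(_ d0) [U [oU NU Ud]].
have mU : measurable U by exact: open_measurable.
(* An ordered list of intervals inside [U], left of [x]: it records the steps whose growth is
   charged to the variation of [psi] instead of to its slope. *)
pose fam n (p q : nat -> R) x :=
  (forall i, (i < n)%N -> [/\ a <= p i, p i < q i, q i <= x & `]p i, q i[ `<=` U]) /\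
  (forall i j, (i < j < n)%N -> q i <= p j).
pose var n (p q : nat -> R) := \sum_(i < n) `|psi (q i) - psi (p i)|.
pose good x := exists n p q, fam n p q x /\ psi x - psi a <= e * (x - a) + var n p q.
suff [n [p [q [[fam1 fam2] gb]]]] : good b.
  have tr : trivIset [set: 'I_n] (fun i : 'I_n => `]p i, q i[%classic).
    move=> i j _ _ [x [/=]]; rewrite !in_itv/= => /andP[pi qi] /andP[pj qj].
    apply: ord_inj; have [ij|ji|//] := ltngtP (i : nat) j.
      have ijn : (i < j < n)%N by rewrite ij ltn_ord.
      by have := lt_trans (lt_le_trans qi (fam2 _ _ ijn)) pj; rewrite ltxx.
    have jin : (j < i < n)%N by rewrite ji ltn_ord.
    by have := lt_trans (lt_le_trans qj (fam2 _ _ jin)) pi; rewrite ltxx.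
  suff : var n p q < e by lra.
  apply: (hd n (fun i => p i) (fun i => q i)) => [i||].
  - by have [] := fam1 i (ltn_ord i).
  - exact: tr.
  - rewrite -lte_fin; apply: le_lt_trans Ud; apply: sum_itv_le => //.
    by move=> i /fam1[].
apply: (@real_induction a b
  (fun x y => psi y - psi x <= e * (y - x) \/ `]x, y[ `<=` U) good) => //.
- exists 0%N, (fun=> 0), (fun=> 0); split; first by split => // i j; rewrite ltn0 andbF.
  by rewrite /var big_ord0 !subrr mulr0 addr0.
- move=> x y ax yb xy [n [p [q [[fam1 fam2] gx]]]] [small|xyU].
    exists n, p, q; split; last by lra.
    split => // i /fam1 [h1 h2 h3 h4]; split => //; exact: le_trans h3 (ltW xy).
  exists n.+1, (fun i => if i == n then x else p i), (fun i => if i == n then y else q i).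
  split; last first.
    rewrite /var big_ord_recr /= eqxx.
    under eq_bigr => i _ do rewrite (ltn_eqF (ltn_ord i)).
    rewrite -/(var n p q); have := ler_norm (psi y - psi x); nra.
  split=> [i|i j].
    rewrite ltnS leq_eqVlt => /orP[/eqP ->|lt_in]; first by rewrite eqxx.
    have [h1 h2 h3 h4] := fam1 _ lt_in.
    by rewrite (ltn_eqF lt_in); split => //; exact: le_trans h3 (ltW xy).
  move=> /andP[ij]; rewrite ltnS leq_eqVlt => /orP[/eqP jn|lt_jn].
    rewrite jn in ij *; rewrite eqxx (ltn_eqF ij).
    by have [] := fam1 i ij.
  rewrite (ltn_eqF lt_jn) (ltn_eqF (ltn_trans ij lt_jn)); apply: fam2; exact/andP.
- move=> t /andP[at_ tb]; have [Ut|nUt] := pselect (U t).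
    move: oU; rewrite openE => /(_ _ Ut); rewrite /interior => /nbhs_ballP[r /= r0 rU].
    exists r => // s1 s2 _ s1t ts2 _ lt; right => x /=; rewrite in_itv/= => /andP[s1x xs2].
    by apply: rU; rewrite /ball/= ltr_norml; apply/andP; split; lra.
  have tN := contra_not (@NU t) nUt.
  have [] : slope_le psi 0 t /\ True.
    split=> //; apply: contrapT => ns; apply: (tN); left => /= h; apply: ns; apply: h.
    rewrite !lt_neqAle at_ tb !andbT.
    by apply/andP; split; apply/eqP => E; apply: (tN); right; [left|right].
  move=> /(_ e e0)[r r0 hr] _; exists r => // s1 s2 _ s1t ts2 _ lt; left.
  by have := hr _ _ s1t ts2 lt; rewrite add0r.
Qed.

End monotonicity.

Section absolute_continuity.
Variables (R : realType) (H : completeNormedModType R).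
Implicit Types (a b : R) (u : R -> H) (psi : R -> R).
Local Notation ac a b psi := (@absolutely_continuous_on R R^o a b psi).

Lemma ac_sub a b a' b' u : a <= a' -> b' <= b ->
  absolutely_continuous_on a b u -> absolutely_continuous_on a' b' u.
Proof.
move=> aa bb acu e /acu[d d0 hd]; exists d => // n p q pq; apply: hd => i.
by have [h1 [h2 h3]] := pq i; split; [exact: le_trans h1|split=> //; exact: le_trans bb].
Qed.

Lemma ac_lip a b u (C : R) psi : absolutely_continuous_on a b u ->
  (forall x y, a <= x -> x < y -> y <= b -> `|psi y - psi x| <= C * `|u y - u x|) ->
  ac a b psi.
Proof.
(* The maximum with 1 gives a positive divisor whatever the sign of [C]. *)
move=> acu lip e e0; pose C' := Num.max C 1.
have C'0 : 0 < C' by rewrite lt_max ltr01 orbT.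
have [d d0 hd] := acu (e / C') (divr_gt0 e0 C'0).
exists d => // n p q pq tr lt; have := hd n p q pq tr lt.
rewrite ltr_pdivlMr// => h.
apply: le_lt_trans h; rewrite mulr_suml; apply: ler_sum => i _.
have [h1 [h2 h3]] := pq i.
apply: le_trans (lip _ _ h1 h2 h3) _; rewrite mulrC; apply: ler_wpM2l => //.
by rewrite le_max lexx.
Qed.

Lemma acD a b psi1 psi2 : ac a b psi1 -> ac a b psi2 -> ac a b (psi1 \+ psi2).
Proof.
move=> ac1 ac2 e e0; have e2 : 0 < e / 2 by rewrite divr_gt0.
have [d1 d10 h1] := ac1 _ e2; have [d2 d20 h2] := ac2 _ e2.
exists (Num.min d1 d2); first by rewrite lt_min d10.
move=> n p q pq tr; rewrite lt_min => /andP[lt1 lt2].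
have := h1 n p q pq tr lt1; have := h2 n p q pq tr lt2 => l2 l1.
apply: (@le_lt_trans _ _ (\sum_(i < n) `|psi1 (q i) - psi1 (p i)| +
    \sum_(i < n) `|psi2 (q i) - psi2 (p i)|)); last first.
  by rewrite [ltRHS](splitr e); exact: ltrD.
rewrite -big_split /=; apply: ler_sum => i _.
by rewrite opprD addrACA ler_normD.
Qed.

Lemma ac_id a b : ac a b id.
Proof.
move=> e e0; exists e => // n p q pq _ lt.
under eq_bigr => i _ do rewrite /= ger0_norm ?subr_ge0 ?(ltW (pq i).2.1)//.
exact: lt.
Qed.

End absolute_continuity.

Lemma acMl (R : realType) (a b C : R) (psi : R -> R) :
  @absolutely_continuous_on R R^o a b psi ->
  @absolutely_continuous_on R R^o a b (fun x => C * psi x).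
Proof.
move=> acp; apply: (ac_lip acp (C := `|C|)) => x y _ _ _.
by rewrite -mulrBr normrM.
Qed.

Section slopes.
Variable R : realType.
Implicit Types (k t C : R) (psi : R -> R).

Lemma slope_leW psi k k' t : k <= k' -> slope_le psi k t -> slope_le psi k' t.
Proof.
move=> kk sl e /sl[d d0 hd]; exists d => // s1 s2 h1 h2 lt.
by apply: le_trans (hd _ _ h1 h2 lt) _; apply: ler_wpM2r; lra.
Qed.

Lemma slope_leD psi1 psi2 k1 k2 t : slope_le psi1 k1 t -> slope_le psi2 k2 t ->
  slope_le (psi1 \+ psi2) (k1 + k2) t.
Proof.
move=> sl1 sl2 e e0; have e2 : 0 < e / 2 by rewrite divr_gt0.
have [d1 d10 h1] := sl1 _ e2; have [d2 d20 h2] := sl2 _ e2.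
exists (Num.min d1 d2); first by rewrite lt_min d10.
move=> s1 s2 le1 le2; rewrite lt_min => /andP[lt1 lt2] /=.
have := h1 _ _ le1 le2 lt1; have := h2 _ _ le1 le2 lt2; lra.
Qed.

Lemma slope_leM psi C k t : 0 <= C -> slope_le psi k t ->
  slope_le (fun x => C * psi x) (C * k) t.
Proof.
move=> C0 sl e e0; have e2 : 0 < e / (C + 1) by rewrite divr_gt0//; lra.
have [d d0 h] := sl _ e2; exists d => // s1 s2 le1 le2 lt.
have := ler_wpM2l C0 (h _ _ le1 le2 lt); rewrite mulrBr => /le_trans; apply.
rewrite mulrA; apply: ler_wpM2r; first lra.
rewrite mulrDr lerD2l mulrA ler_pdivrMr; last lra.
nra.
Qed.

Lemma slope_le_affine C k t : slope_le (fun x => k * (x - C)) k t.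
Proof. by move=> e e0; exists 1 => // s1 s2 le1 le2 _; nra. Qed.

End slopes.

Section derivable.
Variables (R : realType) (H : completeNormedModType R).
Implicit Types (u : R -> H) (t : R).

(** The first-order expansions at [t] towards [s2] and [s1] are subtracted; their errors add up to
    [e * (s2 - s1)]. *)
Lemma derivable_straddle u t (w : H) : derivable (u : R^o -> H) t 1 ->
  derive1 (u : R^o -> H) t = w ->
  forall e, 0 < e -> exists2 d, 0 < d &
    forall s1 s2, s1 <= t -> t <= s2 -> s2 - s1 < d ->
      `|u s2 - u s1 - (s2 - s1) *: w| <= e * (s2 - s1).
Proof.
move=> du wE e e0.
have cv : h^-1 *: (u (h + t) - u t) @[h --> 0^'] --> w.
  rewrite -wE; move: du; rewrite /derivable /derive1.
  set g1 := (X in cvg (X @ _) -> _); set g2 := (X in _ -> X @ _ --> _).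
  suff -> : g1 = g2 by [].
  by apply/funext => h; rewrite /g1 /g2 /= [_%:A]mulr1.
move/cvgrPdist_le : cv => /(_ e e0); rewrite near_withinE => /nbhs_ballP[d /= d0 hd].
have side h : `|h| < d -> `|u (h + t) - u t - h *: w| <= e * `|h|.
  move=> hlt; have [->|h0] := eqVneq h 0.
    by rewrite add0r subrr scale0r subrr !normr0 mulr0.
  have := hd h; rewrite /ball/= sub0r normrN => /(_ hlt h0).
  move=> /(ler_wpM2r (normr_ge0 h)); rewrite mulrC -normrZ scalerBr scalerA.
  by rewrite divff// scale1r distrC.
exists d => // s1 s2 le1 le2 lt.
have := side (s2 - t); rewrite subrK ger0_norm ?subr_ge0// => /(_ _) h2.
have := side (s1 - t); rewrite subrK ler0_norm ?subr_le0// => /(_ _) h1.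
have {}h2 := h2 ltac:(lra); have {}h1 := h1 ltac:(lra).
have -> : u s2 - u s1 - (s2 - s1) *: w =
    (u s2 - u t - (s2 - t) *: w) - (u s1 - u t - (s1 - t) *: w).
  have -> : (s2 - s1) *: w = (s2 - t) *: w - (s1 - t) *: w.
    by rewrite -scalerBl; congr (_ *: _); ring.
  move: ((s2 - t) *: w) ((s1 - t) *: w) => p q.
  rewrite (addrAC _ _ (- p)) (addrAC _ _ (- q)) (opprB _ (u t)) addrA subrK.
  by rewrite !opprB !addrA (addrAC (u s2 - p)) (addrAC _ (- p)) (addrAC _ q).
apply: le_trans (ler_normB _ _) _; lra.
Qed.

End derivable.

Lemma derivable_slope_le (R : realType) (psi : R -> R) (t k : R) :
  derivable (psi : R^o -> R^o) t 1 -> derive1 (psi : R^o -> R^o) t = k ->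
  slope_le psi k t.
Proof.
move=> dpsi kE e e0.
have [d d0 hd] := @derivable_straddle R R^o psi t k dpsi kE e e0.
exists d => // s1 s2 le1 le2 lt; have := hd s1 s2 le1 le2 lt.
move=> /(le_trans (ler_norm _)); rewrite /GRing.scale/=; lra.
Qed.

(** * Slopes along a trajectory *)

Section trajectory_slopes.
Variables (R : realType) (H : completeNormedModType R) (ip : {dot H for idfun}).
Hypothesis ip_norm : induces_norm ip.
Variables (T : H -> H) (T_nonexp : forall x y, `|T x - T y| <= `|x - y|).
Variables (u : R -> H) (t th : R) (ft : H).
Hypotheses (th_ge0 : 0 <= th) (u_derivable : derivable (u : R^o -> H) t 1)
  (u_ode : derive1 (u : R^o -> H) t + th *: (u t - T (u t)) = ft).

(** Evaluating the residual at [s1] instead of [t] costs only a small multiple of the step, as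
    [id - T] is 2-Lipschitz. In exchange [u s2] is, up to [ft] and [r], a convex combination of
    [u s1] and [T (u s1)], to which nonexpansiveness applies. *)
Lemma euler_step e : 0 < e -> exists2 d, 0 < d &
  forall s1 s2, s1 <= t -> t <= s2 -> s2 - s1 < d ->
    th * (s2 - s1) <= 1 /\ exists2 r, `|r| <= e * (s2 - s1) &
      u s2 = u s1 + (s2 - s1) *: ft + r - (th * (s2 - s1)) *: (u s1 - T (u s1)).
Proof.
move=> e0; have ode := u_ode; set w := derive1 (u : R^o -> H) t in ode.
have e2 : 0 < e / 2 by rewrite divr_gt0.
have [d1 d10 hd] := derivable_straddle u_derivable (erefl w) e2.
have w0 := normr_ge0 w; have th0 := th_ge0.
have a0 : 0 < 4 * (th + 1) * (`|w| + e) by rewrite !mulr_gt0//; lra.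
(* This keeps the cost of moving the residual to [s1], at most [2 * th * h * (|w| + e) * h] for a
   step [h], below [e / 2 * h]. *)
pose d2 := e / (4 * (th + 1) * (`|w| + e)).
have d20 : 0 < d2 by rewrite divr_gt0.
have d30 : 0 < (th + 1)^-1 by rewrite invr_gt0; lra.
exists (Num.min d1 (Num.min d2 (th + 1)^-1)); first by rewrite !lt_min d10 d20.
move=> s1 s2 le1 le2; rewrite !lt_min => /and3P[lt1 lt2 lt3].
have h0 : 0 <= s2 - s1 by lra.
split.
  have : (s2 - s1) * (th + 1) <= 1 by rewrite -ler_pdivlMr ?div1r ?ltW//; lra.
  nra.
exists ((u s2 - u s1 - (s2 - s1) *: w) +
  (th * (s2 - s1)) *: ((u s1 - T (u s1)) - (u t - T (u t)))); last first.
  by rewrite -ode; vec_eq ip_norm.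
apply: le_trans (ler_normD _ _) _.
apply: (@le_trans _ _ (e / 2 * (s2 - s1) + e / 2 * (s2 - s1))); last lra.
apply: lerD; first exact: hd.
rewrite normrZ ger0_norm ?mulr_ge0//.
have ht : `|u t - u s1| <= (`|w| + e) * (s2 - s1).
  have := hd s1 t le1 (lexx _) ltac:(lra) => h.
  have -> : u t - u s1 = (u t - u s1 - (t - s1) *: w) + (t - s1) *: w by rewrite subrK.
  apply: le_trans (ler_normD _ _) _.
  rewrite normrZ ger0_norm ?subr_ge0//; nra.
have hv : `|u s1 - T (u s1) - (u t - T (u t))| <= 2 * `|u t - u s1|.
  have -> : u s1 - T (u s1) - (u t - T (u t)) = (T (u t) - T (u s1)) - (u t - u s1).
    by vec_eq ip_norm.
  by apply: le_trans (ler_normB _ _) _; have := T_nonexp (u t) (u s1); lra.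
have {}lt2 : (s2 - s1) * (4 * (th + 1) * (`|w| + e)) <= e.
  by rewrite -ler_pdivlMr// ltW.
have hv2 : `|u s1 - T (u s1) - (u t - T (u t))| <= 2 * ((`|w| + e) * (s2 - s1)) by lra.
have thh : 0 <= th * (s2 - s1) by exact: mulr_ge0.
apply: le_trans (ler_wpM2l thh hv2) _.
have : (s2 - s1) * ((s2 - s1) * (4 * (th + 1) * (`|w| + e))) <= (s2 - s1) * e.
  exact: ler_wpM2l.
have : 0 <= (s2 - s1) * (s2 - s1) * (`|w| + e) by rewrite !mulr_ge0//; lra.
move: (`|w|) => W; lra.
Qed.

(** Go from [T (u s2)] to [u s2] through [T (u s1)]: the two legs carry the weights [th * h] and
    [1 - th * h] of the old residual, so [th] cancels and [ft] is counted twice. *)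
Lemma slope_le_residual : slope_le (fun x => `|T (u x) - u x|) (2 * `|ft|) t.
Proof.
move=> e e0; have e2 : 0 < e / 2 by rewrite divr_gt0.
have [d d0 hd] := euler_step e2; exists d => // s1 s2 le1 le2 lt.
have [th1 [r rle uE]] := hd s1 s2 le1 le2 lt.
have h0 : 0 <= s2 - s1 by lra.
have th0 : 0 <= th * (s2 - s1) by exact: mulr_ge0.
move: (s2 - s1) h0 th0 th1 rle uE => h h0 th0 th1 rle uE.
have step : `|u s2 - u s1| <= th * h * `|T (u s1) - u s1| + h * `|ft| + `|r|.
  have -> : u s2 - u s1 = (th * h) *: (T (u s1) - u s1) + h *: ft + r.
    by rewrite uE; vec_eq ip_norm.
  apply: le_trans (ler_normD _ _) _; rewrite lerD2r.
  by apply: le_trans (ler_normD _ _) _; rewrite !normrZ !ger0_norm.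
have stepT : `|T (u s1) - u s2| <= (1 - th * h) * `|T (u s1) - u s1| + h * `|ft| + `|r|.
  have -> : T (u s1) - u s2 = (1 - th * h) *: (T (u s1) - u s1) - h *: ft - r.
    by rewrite uE; vec_eq ip_norm.
  apply: le_trans (ler_normB _ _) _; rewrite lerD2r.
  by apply: le_trans (ler_normB _ _) _; rewrite !normrZ !ger0_norm// subr_ge0.
have := ler_distD (T (u s1)) (T (u s2)) (u s2).
have := T_nonexp (u s2) (u s1); lra.
Qed.

Lemma slope_le_dist p : T p = p -> slope_le (fun x => `|u x - p|) (`|ft|) t.
Proof.
move=> Tp e e0; have [d d0 hd] := euler_step e0; exists d => // s1 s2 le1 le2 lt.
have [th1 [r rle uE]] := hd s1 s2 le1 le2 lt.
have h0 : 0 <= s2 - s1 by lra.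
have th0 : 0 <= th * (s2 - s1) by exact: mulr_ge0.
move: (s2 - s1) h0 th0 th1 rle uE => h h0 th0 th1 rle uE.
have -> : u s2 - p = (1 - th * h) *: (u s1 - p) + (th * h) *: (T (u s1) - p) +
    h *: ft + r by rewrite uE; vec_eq ip_norm.
have Tup : `|T (u s1) - p| <= `|u s1 - p| by rewrite -{1}Tp.
have : `|(1 - th * h) *: (u s1 - p) + (th * h) *: (T (u s1) - p) + h *: ft + r| <=
    (1 - th * h) * `|u s1 - p| + (th * h) * `|T (u s1) - p| + h * `|ft| + `|r|.
  apply: le_trans (ler_normD _ _) _; rewrite lerD2r.
  apply: le_trans (ler_normD _ _) _; rewrite normrZ (ger0_norm h0) lerD2r.
  by apply: le_trans (ler_normD _ _) _; rewrite !normrZ !ger0_norm// subr_ge0.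
have := ler_wpM2l th0 Tup; lra.
Qed.

Lemma slope_le_sqdist_derive p (w : H) : derive1 (u : R^o -> H) t = w ->
  slope_le (fun x => `|u x - p| ^+ 2) (2 * ip w (u t - p)) t.
Proof.
move=> wE e e0; pose a := u t - p.
have w0 := normr_ge0 w; have a0 := normr_ge0 a.
(* The increment is the linear term plus [2 * ip r a] plus a second-order term. [e1] bounds the
   former by [e / 2] per unit of step and gives [u] the Lipschitz bound [|w| + 1] around [t]; the
   step size below does the same for the latter. *)
pose e1 := Num.min 1 (e / (4 * (`|a| + 1))).
have e10 : 0 < e1 by rewrite lt_min ltr01 divr_gt0// mulr_gt0//; lra.
have e1_le1 : e1 <= 1 by rewrite ge_min lexx.
have e1a : e1 * (4 * (`|a| + 1)) <= e.
  by rewrite -ler_pdivlMr ?mulr_gt0 ?ge_min ?lexx ?orbT//; lra.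
have [d d0 hd] := derivable_straddle u_derivable wE e10.
have w1 : 0 < 4 * (`|w| + 1) ^+ 2 by rewrite mulr_gt0// exprn_gt0//; lra.
exists (Num.min d (e / (4 * (`|w| + 1) ^+ 2))).
  by rewrite lt_min d0 divr_gt0.
move=> s1 s2 le1 le2; rewrite lt_min ltr_pdivlMr// => /andP[lt1 lt2].
have near_t s : s1 <= s -> s <= s2 -> `|u s - u t| <= (`|w| + 1) * (s2 - s1).
  move=> s1s ss2; have st : `|u s - u t - (s - t) *: w| <= e1 * `|s - t|.
    have [ts|st] := leP t s.
      by rewrite ger0_norm ?subr_ge0//; apply: hd => //; lra.
    rewrite distrC ler0_norm; last lra.
    rewrite -normrN.
    have -> : - ((s - t) *: w - (u s - u t)) = - (u t - u s - (t - s) *: w) by vec_eq ip_norm.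
    by rewrite normrN opprB; apply: hd; lra.
  have -> : u s - u t = (u s - u t - (s - t) *: w) + (s - t) *: w by rewrite subrK.
  apply: le_trans (ler_normD _ _) _; rewrite normrZ.
  have : `|s - t| <= s2 - s1 by rewrite ler_norml; apply/andP; split; lra.
  have := normr_ge0 (s - t); nra.
pose r := u s2 - u s1 - (s2 - s1) *: w.
have rle : `|r| <= e1 * (s2 - s1) by exact: hd.
pose z := (u s2 - u t) + (u s1 - u t).
have zle : `|z| <= 2 * ((`|w| + 1) * (s2 - s1)).
  apply: le_trans (ler_normD _ _) _.
  have := near_t s1 (lexx _) ltac:(lra); have := near_t s2 ltac:(lra) (lexx _); lra.
have dle : `|u s2 - u s1| <= (`|w| + 1) * (s2 - s1).
  have -> : u s2 - u s1 = r + (s2 - s1) *: w by rewrite subrK.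
  apply: le_trans (ler_normD _ _) _; rewrite normrZ ger0_norm; last lra.
  nra.
have -> : `|u s2 - p| ^+ 2 - `|u s1 - p| ^+ 2 =
    2 * ip w a * (s2 - s1) + 2 * ip r a + ip (u s2 - u s1) z.
  by rewrite -!(ip_self ip_norm) /r /a /z !ip_linear
    ?(ipC ip (u s1) (u s2)) ?(ipC ip (u s2) (u t)) ?(ipC ip (u s1) (u t))
    ?(ipC ip p (u t)) ?(ipC ip p (u s1)) ?(ipC ip p (u s2)); ring.
have := cauchy_schwarz ip_norm r a.
have := cauchy_schwarz ip_norm (u s2 - u s1) z.
have h0 : 0 <= s2 - s1 by lra.
have c1 := ler_pM (normr_ge0 _) (normr_ge0 _) dle zle.
have c2 := ler_wpM2r a0 rle.
have c3 : (s2 - s1) * ((s2 - s1) * (4 * (`|w| + 1) ^+ 2)) <= (s2 - s1) * e.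
  by apply: ler_wpM2l => //; exact: ltW.
have c4 := ler_wpM2r h0 e1a.
have c5 : 0 <= e1 * (s2 - s1) by apply: mulr_ge0 => //; exact: ltW.
move: c1 c2 c3 c4 c5; move: (`|u s2 - u s1|) (`|z|) (`|r|) => x y z'.
rewrite -/a; move: (s2 - s1) (`|a|) (`|w|) => h A W; nra.
Qed.

(** Squaring and expanding [|T u - p| <= |u - p|] gives [2 <u - p, u - T u> >= |u - T u|^2], the
    source of the dissipation. *)
Lemma slope_le_sqdist p : T p = p ->
  slope_le (fun x => `|u x - p| ^+ 2)
    (2 * `|ft| * `|u t - p| - th * `|T (u t) - u t| ^+ 2) t.
Proof.
move=> Tp; have ode := u_ode; set w := derive1 (u : R^o -> H) t in ode.
apply: slope_leW (slope_le_sqdist_derive p (erefl w)).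
have wE : w = ft - th *: (u t - T (u t)) by rewrite -ode addrK.
have Tup : `|T (u t) - p| <= `|u t - p| by rewrite -{1}Tp.
have {Tup} : ip (T (u t) - p) (T (u t) - p) <= ip (u t - p) (u t - p).
  by rewrite !(ip_self ip_norm) lerXn2r ?nnegrE.
have -> : T (u t) - p = (u t - p) - (u t - T (u t)) by vec_eq ip_norm.
rewrite wE (distrC (T (u t)) (u t)).
have := cauchy_schwarz ip_norm ft (u t - p).
move: (u t - p) (u t - T (u t)) => a v cs.
rewrite -(ip_self ip_norm) !ip_linear (ipC ip a v) => h.
have := ler_wpM2l th_ge0 h; lra.
Qed.

End trajectory_slopes.

(** * Energy estimate along a trajectory *)

Section energy.
Variables (R : realType) (H : completeNormedModType R) (ip : {dot H for idfun}).
Hypothesis ip_norm : induces_norm ip.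
Local Notation leb := (@lebesgue_measure R).
Local Notation ac a b psi := (@absolutely_continuous_on R R^o a b psi).
Variables (T : H -> H) (T_nonexp : forall x y, `|T x - T y| <= `|x - y|).
Variables (p : H) (Tp : T p = p).
Variables (t0 c : R) (theta : R -> R) (f u : R -> H).
Hypotheses (c_gt0 : 0 < c) (theta_ge : forall t, t0 <= t -> c <= theta t).
Hypothesis u_ac : forall b, t0 < b -> absolutely_continuous_on t0 b u.
Hypothesis u_ode : {ae leb, forall t, t0 <= t -> derivable (u : R^o -> H) t 1 /\
  derive1 (u : R^o -> H) t + theta t *: (u t - T (u t)) = f t}.
(** [F] stands for the tail integral of [|f|] and [K] for a primitive of [F]; they stay abstract so
    that both can be zero when [f] is. *)
Variables (F K : R -> R).
Hypotheses (F_ge0 : forall t, t0 <= t -> 0 <= F t)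
  (F_ac : forall b, t0 < b -> ac t0 b F)
  (F_slope : {ae leb, forall t, t0 < t -> slope_le F (- `|f t|) t})
  (K_ac : forall b, t0 < b -> ac t0 b K)
  (K_slope : {ae leb, forall t, t0 < t -> slope_le (fun x => - K x) (- F t) t}).

Let residual x := `|T (u x) - u x|.
Let dist x := `|u x - p|.

Let M := dist t0 + F t0.

Let residual_ac b : t0 < b -> ac t0 b residual.
Proof.
move=> /u_ac acu; apply: (ac_lip acu (C := 2)) => x y _ _ _; rewrite /residual.
apply: le_trans (ler_dist_dist _ _) _.
have -> : T (u y) - u y - (T (u x) - u x) = (T (u y) - T (u x)) - (u y - u x).
  by vec_eq ip_norm.
apply: le_trans (ler_normB _ _) _; have := T_nonexp (u y) (u x); lra.
Qed.

Let dist_ac b : t0 < b -> ac t0 b dist.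
Proof.
move=> /u_ac acu; apply: (ac_lip acu (C := 1)) => x y _ _ _; rewrite /dist mul1r.
apply: le_trans (ler_dist_dist _ _) _.
by have -> : u y - p - (u x - p) = u y - u x by vec_eq ip_norm.
Qed.

Let ode_slope (P : R -> Prop) :
  (forall t, t0 < t -> derivable (u : R^o -> H) t 1 ->
    derive1 (u : R^o -> H) t + theta t *: (u t - T (u t)) = f t ->
    slope_le F (- `|f t|) t -> slope_le (fun x => - K x) (- F t) t -> P t) ->
  {ae leb, forall t, t0 < t -> P t}.
Proof.
move=> h; have := ae_lebesgueI u_ode (ae_lebesgueI F_slope K_slope).
apply: ae_lebesgueS => t [h1 [h2 h3]] tt.
have [? ?] := h1 (ltW tt); apply: h => //; [exact: h2|exact: h3].
Qed.

Let noninc psi s t : t0 <= s -> s <= t -> (forall b, t0 < b -> ac t0 b psi) ->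
  {ae leb, forall x, t0 < x -> s < x < t -> slope_le psi 0 x} -> psi t <= psi s.
Proof.
move=> ts st acp slp; have [->//|/eqP sneqt] := pselect (s = t).
have {}st : s < t by rewrite lt_neqAle sneqt.
apply: (ac_slope_le0 (ltW st)).
  by apply: (ac_sub ts (lexx t)); apply: acp; lra.
apply: ae_lebesgueS slp => x h /andP[sx xt]; apply: h; first lra.
by rewrite sx xt.
Qed.

Lemma tail_nonincreasing s t : t0 <= s -> s <= t -> F t <= F s.
Proof.
move=> ts st; apply: noninc => //.
apply: ae_lebesgueS F_slope => x h /h + _; apply: slope_leW.
by rewrite oppr_le0.
Qed.

Lemma residual_nonincreasing s t : t0 <= s -> s <= t ->
  residual t + 2 * F t <= residual s + 2 * F s.
Proof.
move=> ts st; apply: (noninc (psi := residual \+ (fun x => 2 * F x))) => //.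
  by move=> b tb; apply: acD; [exact: residual_ac|apply: acMl; exact: F_ac].
apply: ode_slope => x tx dx ode sF _ _.
have th0 : 0 <= theta x by have := theta_ge (ltW tx); move: c_gt0 => ?; lra.
have := slope_leD (slope_le_residual ip_norm T_nonexp th0 dx ode) (slope_leM (ler0n R 2) sF).
by apply: slope_leW; rewrite mulrN subrr.
Qed.

Lemma dist_nonincreasing s t : t0 <= s -> s <= t -> dist t + F t <= dist s + F s.
Proof.
move=> ts st; apply: (noninc (psi := dist \+ F)) => //.
  by move=> b tb; apply: acD; [exact: dist_ac|exact: F_ac].
apply: ode_slope => x tx dx ode sF _ _.
have th0 : 0 <= theta x by have := theta_ge (ltW tx); move: c_gt0 => ?; lra.
have := slope_leD (slope_le_dist ip_norm T_nonexp th0 dx ode Tp) sF.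
by apply: slope_leW; rewrite subrr.
Qed.

Lemma dist_le s t : t0 <= s -> s <= t -> dist t <= dist s + F s.
Proof.
move=> ts st; have := dist_nonincreasing ts st.
have := F_ge0 (le_trans ts st); lra.
Qed.

(* The residual decreases up to the correction 2 F, so along [s, t] it stays above
   its final value and the dissipation of |u - p|^2 controls (t - s) times it. *)
Lemma energy_le s t : t0 <= s -> s <= t ->
  dist t ^+ 2 + 2 * M * F t + c / 2 * (t - s) * (residual t + 2 * F t) ^+ 2 <=
  dist s ^+ 2 + 2 * M * F s + 4 * c * F t0 * (K t - K s).
Proof.
move=> ts st.
have M0 : 0 <= M by rewrite addr_ge0 ?normr_ge0 ?F_ge0.
have F0 := F_ge0 (lexx t0).
pose L := residual t + 2 * F t.
have L0 : 0 <= L by rewrite addr_ge0 ?normr_ge0 ?mulr_ge0 ?F_ge0//; lra.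
(* The term in [F] absorbs the forcing [2 * |f| * dist], since [dist <= M]; the affine term is the
   dissipation claimed; the term in [K] absorbs the correction [F ^+ 2]. *)
pose psi := (fun x => dist x ^+ 2) \+ (fun x => 2 * M * F x) \+
  (fun x => c / 2 * L ^+ 2 * (x - s)) \+ (fun x => 4 * c * F t0 * (- K x)).
suff : psi t <= psi s by rewrite /psi /= -/L; move: (L ^+ 2) => X; lra.
apply: (noninc (psi := psi)) => //.
  move=> b tb; apply: acD; [apply: acD; [apply: acD|]|].
  - apply: (ac_lip (dist_ac tb) (C := 2 * M)) => x y tx xy yb.
    have h1 : dist x <= M by exact: dist_le.
    have h2 : dist y <= M by apply: dist_le; lra.
    have -> : dist y ^+ 2 - dist x ^+ 2 = (dist y + dist x) * (dist y - dist x) by ring.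
    rewrite normrM; apply: ler_wpM2r => //.
    by rewrite ger0_norm ?addr_ge0 ?normr_ge0//; lra.
  - by apply: acMl; exact: F_ac.
  - apply: acMl; apply: (ac_lip (@ac_id R t0 b) (C := 1)) => x y _ _ _.
    by rewrite mul1r; have -> : y - s - (x - s) = y - x by ring.
  - apply: acMl; apply: (ac_lip (K_ac tb) (C := 1)) => x y _ _ _.
    by rewrite mul1r -opprD normrN.
apply: ode_slope => x tx dx ode sF sK /andP[sx xt].
have th0 : 0 <= theta x by have := theta_ge (ltW tx); move: c_gt0 => ?; lra.
have c4 : 0 <= 4 * c * F t0 by rewrite !mulr_ge0// ltW.
have M2 : 0 <= 2 * M by rewrite mulr_ge0.
have := slope_leD (slope_leD (slope_leD (slope_le_sqdist ip_norm T_nonexp th0 dx ode Tp)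
  (slope_leM M2 sF)) (slope_le_affine s (c / 2 * L ^+ 2) x)) (slope_leM c4 sK).
apply: slope_leW.
have hd : dist x <= M by apply: dist_le; lra.
have hL : L <= residual x + 2 * F x by apply: residual_nonincreasing; lra.
have hF : F x <= F t0 by apply: tail_nonincreasing; lra.
have Fx0 : 0 <= F x by apply: F_ge0; lra.
have := theta_ge (ltW tx); rewrite -/(residual x) -/(dist x).
have r0 : 0 <= residual x by exact: normr_ge0.
have n0 := normr_ge0 (f x).
move: c_gt0 (residual x) (dist x) (F x) (theta x) (`|f x|) n0 r0 Fx0 hF hL hd th0.
clear psi; move: {dx ode sF sK c4 M2} M M0 F0 L L0 => m M0 F0 L L0.
move: (F t0) F0 => F' F0 c0 r d Fx th n n0 r0 Fx0 hF hL hd th0 cth.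
have h1 : n * d <= n * m by exact: ler_wpM2l.
have h2 : c * r ^+ 2 <= th * r ^+ 2 by apply: ler_wpM2r => //; exact: sqr_ge0.
(* Multiplied by [c / 2], the last term becomes [4 * c * Fx ^+ 2]; by [h5] it is at most
   [4 * c * F' * Fx], which is the slope supplied by [K]. *)
have h3 : L ^+ 2 <= 2 * r ^+ 2 + 8 * Fx ^+ 2.
  have : L ^+ 2 <= (r + 2 * Fx) ^+ 2 by rewrite lerXn2r ?nnegrE//; lra.
  have := sqr_ge0 (r - 2 * Fx); lra.
have h4 : c * L ^+ 2 <= c * (2 * r ^+ 2 + 8 * Fx ^+ 2) by rewrite ler_pM2l.
have h5 : c * (Fx * Fx) <= c * (F' * Fx) by rewrite ler_pM2l//; exact: ler_wpM2r.
lra.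
Qed.

End energy.

(** * Tail integrals *)

Section integrals.
Variable R : realType.
Local Notation leb := (@lebesgue_measure R).

(* [f2] will be [|f|] or [theta], which are only almost everywhere equal to Borel
   functions. *)
Lemma ge0_le_integral_subset (D1 D2 : set R) (f1 f2 : R -> \bar R) :
  (forall x, D1 x -> 0 <= f1 x)%E -> (forall x, D2 x -> 0 <= f2 x)%E ->
  (forall x, D1 x -> f1 x != 0%E -> D2 x /\ (f1 x <= f2 x)%E) ->
  (\int[leb]_(x in D1) f1 x <= \int[leb]_(x in D2) f2 x)%E.
Proof.
move=> f10 f20 f12; rewrite !ge0_integralE//.
apply: le_ereal_sup => _ [h hf <-]; exists h => // x; apply: le_trans (hf x) _.
rewrite !patchE; case: ifPn => [|_].
  rewrite inE => /f12; have [-> _|f1x /(_ isT)[D2x le12]] := eqVneq (f1 x) 0%E.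
    by case: ifPn => //; rewrite inE => /f20.
  by rewrite mem_set.
by case: ifPn => //; rewrite inE => /f20.
Qed.

Section primitive.
Variable k : R -> R.
Hypotheses (k_ge0 : forall x, 0 <= k x) (k_int : leb.-integrable setT (EFin \o k)).

Definition primitive x := \int[leb]_(t in `]-oo, x]) k t.

Let k_intS (D : set R) : measurable D -> leb.-integrable D (EFin \o k).
Proof. by move=> mD; apply: integrableS k_int. Qed.

Lemma primitiveB x y : x <= y ->
  primitive y - primitive x = \int[leb]_(t in `]x, y[) k t.
Proof.
move=> xy; rewrite Rintegral_itvB//; last exact: k_intS.
by rewrite Rintegral_itv_bndo_bndc//; exact: k_intS.
Qed.

Lemma primitive_nondecreasing x y : x <= y -> primitive x <= primitive y.
Proof. by move=> xy; rewrite -subr_ge0 primitiveB//; exact: Rintegral_ge0. Qed.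

Lemma primitive_ge0 x : 0 <= primitive x.
Proof. exact: Rintegral_ge0. Qed.

Lemma primitive_tail x : \int[leb]_t k t - primitive x = \int[leb]_(t in `]x, +oo[) k t.
Proof.
by rewrite -set_itvNyy /primitive Rintegral_itvB// set_itvNyy.
Qed.

Lemma primitive_le x : primitive x <= \int[leb]_t k t.
Proof. by rewrite -subr_ge0 primitive_tail; exact: Rintegral_ge0. Qed.

Lemma primitive_ac a b : @absolutely_continuous_on R R^o a b primitive.
Proof.
move=> e e0; have [d [d0 hd]] := integral_normr_continuous k_int e0.
exists d => // n p q pq tr lt.
have mB : measurable (\big[setU/set0]_(i < n) `]p i, q i[%classic).
  by apply: bigsetU_measurable => i _; exact: measurable_itv.
have := hd _ mB; rewrite measure_semi_additive_ord//.
have -> : (\sum_(i < n) leb `]p i, q i[%classic)%E = (\sum_(i < n) (q i - p i))%:E.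
  rewrite -sumEFin; apply: eq_bigr => i _.
  by rewrite lebesgue_measure_itv /= lte_fin (pq i).2.1 EFinB.
rewrite lte_fin => /(_ lt); apply: le_lt_trans.
under eq_Rintegral do rewrite ger0_norm//.
rewrite /Rintegral (integral_bigsetU_EFin _ _ _)//=; last 3 first.
- by rewrite /index_enum; exact: index_enum_uniq.
- by apply: sub_trivIset tr.
- by apply: (measurable_int leb); exact: k_intS.
rewrite -(@sum_fine _ _ _ _ (fun i => \int[leb]_(x in `]p i, q i[) (k x)%:E)%E).
  apply: ler_sum => i _; have [_ [/ltW piq _]] := pq i.
  by rewrite primitiveB// ger0_norm//; exact: Rintegral_ge0.
by move=> i _; apply: integrable_fin_num => //; exact: k_intS.
Qed.

Lemma primitive_derivable : {ae leb, forall x,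
  derivable (primitive : R^o -> R^o) x 1 /\ derive1 (primitive : R^o -> R^o) x = k x}.
Proof.
apply: FTC1Ny; first by move=> y; exact: k_intS.
by apply: open_integrable_locally => //; exact: openT.
Qed.

Lemma primitive_slope : {ae leb, forall x, slope_le (fun x => - primitive x) (- k x) x}.
Proof.
apply: ae_lebesgueS primitive_derivable => x [dk kE].
apply: (derivable_slope_le (psi := \- primitive)).
  exact: derivableN.
by rewrite derive1E deriveN// -derive1E kE.
Qed.

End primitive.

Variable H : completeNormedModType R.

Lemma measurable_norm_simple (s : {fimfun R >-> H}) :
  (forall y, measurable (s @^-1` [set y])) -> measurable_fun setT (fun t => `|s t|).
Proof.
move=> ms _ B mB; rewrite setTI.
have -> : (fun t => `|s t|) @^-1` B =
    \bigcup_(y in range s `&` [set y | B `|y|]) (s @^-1` [set y]).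
  apply/seteqP; split=> [t Bt|t [y [_ By]] /= ->//].
  by exists (s t) => //; split=> //; exists t.
apply: fin_bigcup_measurable => // .
by apply: sub_finite_set (@fimfunP _ _ s) => y [].
Qed.

(** A Borel substitute for [|f|], set to 0 on the null set where the simple functions may not
    converge. Being below [|f|] everywhere, its integrals compare with those of [|f|] directly. *)
Lemma strongly_measurable_norm (D : set R) (f : R -> H) : measurable D ->
  strongly_measurable D f -> exists g : R -> R,
  [/\ measurable_fun setT g, (forall t, 0 <= g t), (forall t, g t != 0 -> D t),
    (forall t, g t <= `|f t|) & {ae leb, forall t, D t -> g t = `|f t|}].
Proof.
move=> mD [s [ms [N [mN N0 sN]]]].
pose E := D `\` N; have mE : measurable E by exact: measurableD.
have cv t : E t -> s n t @[n --> \oo] --> f t.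
  by move=> [Dt Nt]; apply: contrapT => nc; apply: Nt; apply: sN => /= h; apply: nc; exact: h.
have mf : measurable_fun E (fun t => `|f t|).
  apply: (measurable_fun_cvg (h := fun n t => `|s n t|)) => [n|t /cv].
    by apply: measurable_funTS; apply: measurable_norm_simple.
  exact: cvg_norm.
exists ((fun t => `|f t|) \_ E); split.
- exact/(measurable_restrictT _ _).1.
- by move=> t; rewrite patchE; case: ifP => _; [exact: normr_ge0|exact: lexx].
- move=> t; rewrite patchE; case: ifPn => [|_ /eqP[]//].
  by rewrite inE => -[].
- by move=> t; rewrite patchE; case: ifP => _; [exact: lexx|exact: normr_ge0].
- exists N; split => // t /= /not_implyP[Dt]; rewrite patchE.
  by case: ifPn => // /negP; rewrite inE => nE _; apply: contrapT => Nt; apply: nE; split.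
Qed.

End integrals.

(** * Convergence rates *)

Lemma le_div_sqrt (R : realType) (r t C : R) : 0 <= r -> 0 < t -> 0 <= C ->
  r ^+ 2 * t <= C ^+ 2 -> r <= C * (Num.sqrt t)^-1.
Proof.
move=> r0 t0 C0 h; rewrite ler_pdivlMr ?sqrtr_gt0//.
rewrite -(@ler_pXn2r _ 2)// ?nnegrE ?mulr_ge0 ?sqrtr_ge0//.
by rewrite exprMn sqr_sqrtr// ltW.
Qed.

Section tails.
Variables (R : realType) (H : completeNormedModType R).
Local Notation leb := (@lebesgue_measure R).
Local Notation ac a b psi := (@absolutely_continuous_on R R^o a b psi).
Variables (t0 c : R) (theta : R -> R) (f : R -> H).
Hypotheses (c_gt0 : 0 < c) (theta_ge : forall t, t0 <= t -> c <= theta t).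
Hypothesis f_L1 : bochner_L1 `[t0, +oo[ f.
Hypothesis f_theta : (\int[leb]_(s in `[t0, +oo[)
  ((theta s)%:E * \int[leb]_(tau in `[s, +oo[) `|f tau|%:E) < +oo)%E.

(** [F] is integrable on [[t0, +oo[] because [c * F] lies below the integrand of [f_theta]; the
    increments of its primitive [K] are thus bounded by its total integral [C]. *)
Lemma tail_functions : exists F K : R -> R, exists C : R,
  [/\ forall t, t0 <= t -> 0 <= F t,
      forall b, t0 < b -> ac t0 b F,
      {ae leb, forall t, t0 < t -> slope_le F (- `|f t|) t} &
  [/\ forall b, t0 < b -> ac t0 b K,
      {ae leb, forall t, t0 < t -> slope_le (fun x => - K x) (- F t) t} &
      forall s t, K t - K s <= C]].
Proof.
have [fm fI] := f_L1; have mD : measurable (`[t0, +oo[%classic : set R) by exact: measurable_itv.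
have [g [mg g0 gD gf gae]] := strongly_measurable_norm mD fm.
have gfE D1 (D2 : set R) : (forall x, D1 x -> g x != 0 -> D2 x) ->
    (\int[leb]_(t in D1) (g t)%:E <= \int[leb]_(t in D2) `|f t|%:E)%E.
  move=> D12; apply: ge0_le_integral_subset => x.
  - by rewrite lee_fin.
  - by rewrite lee_fin.
  - by rewrite eqe lee_fin => D1x gx; split; [exact: D12|].
have g_int : leb.-integrable setT (EFin \o g).
  apply/integrableP; split; first exact/measurable_EFinP.
  apply: le_lt_trans fI; under eq_integral do rewrite /= ger0_norm//.
  by apply: gfE => x _; exact: gD.
pose F x := \int[leb]_t g t - primitive g x.
have F0 x : 0 <= F x by rewrite subr_ge0 primitive_le.
have Fni x y : x <= y -> F y <= F x.
  by move=> xy; rewrite lerD2l lerN2; exact: primitive_nondecreasing.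
have FE x : ((F x)%:E <= \int[leb]_(tau in `[x, +oo[) `|f tau|%:E)%E.
  rewrite /F primitive_tail// fineK; last first.
    by apply: integrable_fin_num => //; apply: integrableS g_int.
  apply: gfE => y /=; rewrite !in_itv/= !andbT => xy _; exact: ltW.
(* The cut at [t0] is needed because [F] tends to the total integral of [g] at [-oo]. *)
pose k := F \_ `[t0, +oo[.
have k0 x : 0 <= k x by rewrite /k patchE; case: ifP => _; [exact: F0|exact: lexx].
have kF x : t0 <= x -> k x = F x.
  by move=> tx; rewrite /k patchE mem_set//= in_itv/= tx.
have mk : measurable_fun setT k.
  apply/(measurable_restrictT _ _).1 => //; exact: nonincreasing_measurable.
have ck_int : leb.-integrable setT (EFin \o (fun x => c * k x)).
  apply/integrableP; split; first exact/measurable_EFinP/measurable_funM.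
  apply: le_lt_trans f_theta; apply: ge0_le_integral_subset => x.
  - by [].
  - rewrite /= in_itv/= andbT => tx; apply: mule_ge0; last exact: integral_ge0.
    by rewrite lee_fin; have := theta_ge tx; apply: le_trans; exact: ltW.
  - move=> _; rewrite /= (ger0_norm (mulr_ge0 (ltW c_gt0) (k0 x))) eqe mulf_eq0 negb_or.
    move=> /andP[_]; rewrite {1}/k patchE; case: ifPn => [|_ /eqP[]//].
    rewrite inE /= in_itv/= andbT => tx _; split=> //.
    rewrite kF// EFinM; apply: lee_pmul => //.
    + by rewrite lee_fin ltW.
    + by rewrite lee_fin.
    + by rewrite lee_fin theta_ge.
have k_int : leb.-integrable setT (EFin \o k).
  have := @integrableZl _ _ _ leb setT measurableT c^-1 _ ck_int.
  congr (_.-integrable _ _); apply/funext => x /=.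
  by rewrite -EFinM mulrA mulVf ?mul1r// gt_eqF.
exists F, (primitive k), (\int[leb]_t k t); split; last split.
- by move=> t _; exact: F0.
- move=> b _; apply: (ac_lip (primitive_ac g0 g_int t0 b) (C := 1)) => x y _ _ _.
  by rewrite mul1r /F opprB addrC addrA subrK distrC.
- have := ae_lebesgueI gae (primitive_slope g_int).
  apply: ae_lebesgueS => t [gt sl] tt e e0.
  have [d d0 hd] := sl e e0; exists d => // s1 s2 le1 le2 lt.
  rewrite -gt; last by rewrite /= in_itv/= ltW.
  by have := hd _ _ le1 le2 lt; rewrite /F; move: (primitive g s1) (primitive g s2) => P1 P2; lra.
- by move=> b _; exact: primitive_ac.
- have := primitive_slope k_int; apply: ae_lebesgueS => t + tt.
  by rewrite kF// ltW.
- move=> s t; have := primitive_le k0 k_int t; have := primitive_ge0 k0 s.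
  move: (primitive k s) (primitive k t) => P1 P2; lra.
Qed.

End tails.

Theorem theorem4p6 (R : realType) (H : completeNormedModType R)
    (ip : {dot H for idfun}) (ip_norm : induces_norm ip)
    (t0 : R) (t0_gt0 : 0 < t0)
    (theta : R -> R) (theta_ge0 : forall t, t0 <= t -> 0 <= theta t)
    (theta_int : locally_integrable_on `[t0, +oo[ theta)
    (f : R -> H) (f_int : bochner_L1 `[t0, +oo[ f)
    (A B : H -> set H) (alpha beta : R)
    (A_max : maximally_alpha_monotone ip alpha A)
    (B_max : maximally_alpha_monotone ip beta B)
    (alphabeta : 0 <= alpha + beta)
    (gamma delta lambda mu : R)
    (gamma_gt0 : 0 < gamma) (delta_gt0 : 0 < delta)
    (lambda_ge1 : 1 <= lambda) (mu_ge1 : 1 <= mu)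
    (gammaalpha : 0 < 1 + 2 * gamma * alpha)
    (mu_in : mu \in `[2 - 2 * gamma * beta, 2 + 2 * gamma * alpha])
    (lambdamu : (lambda - 1) * (mu - 1) = 1)
    (deltaE : delta = (lambda - 1) * gamma)
    (zerAB : zer (op_add A B) !=set0)
    (theta_inf : 0 < inf [set theta t | t in `[t0, +oo[])
    (T : H -> H)
    (TE : T = relaxed_resolvent delta mu B \o relaxed_resolvent gamma lambda A)
    (u0 : H) (u : R -> H) (u_sol : strong_global_solution t0 theta T f u0 u) :
  ((\int[lebesgue_measure]_(s in `[t0, +oo[)
       ((theta s)%:E *
        \int[lebesgue_measure]_(tau in `[s, +oo[) `|f tau|%:E) < +oo)%E ->
    (fun t => `|T (u t) - u t| : R^o) =O_ +oo (fun t => (Num.sqrt t)^-1 : R^o))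
  /\
  ((forall t, t0 <= t -> f t = 0) ->
    (fun t => `|T (u t) - u t| : R^o) =o_ +oo (fun t => (Num.sqrt t)^-1 : R^o)).
Proof.
have T_nonexp x y : `|T x - T y| <= `|x - y|.
  rewrite TE; exact: (douglas_rachford_nonexpansive ip_norm A_max B_max).
have [p Tp] : exists p, T p = p.
  rewrite TE; exact: (douglas_rachford_fixpoint ip_norm A_max B_max).
pose c := inf [set theta t | t in `[t0, +oo[].
have theta_ge t : t0 <= t -> c <= theta t.
  move=> tt; apply: ge_inf.
    exists 0 => _ [s sD <-]; apply: theta_ge0; move: sD.
    by rewrite /= in_itv/= andbT.
  by exists t => //=; rewrite in_itv/= tt.
have c2_ge0 : 0 <= c / 2 by rewrite divr_ge0// ltW.
have [u_ac u_ode _] := u_sol.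
have energy := energy_le ip_norm T_nonexp Tp theta_inf theta_ge u_ac u_ode.
split.
- move=> f_theta.
  have [F [K [C [F0 F_ac F_slope [K_ac K_slope KC]]]]] := tail_functions theta_inf theta_ge f_int f_theta.
  have {}energy := energy F K F0 F_ac F_slope K_ac K_slope.
  pose M := `|u t0 - p| + F t0.
  pose Q := `|u t0 - p| ^+ 2 + 2 * M * F t0 + 4 * c * F t0 * C.
  have F00 := F0 _ (lexx t0).
  have M0 : 0 <= M by rewrite addr_ge0.
  have Q_ge t : t0 <= t -> c / 2 * (t - t0) * `|T (u t) - u t| ^+ 2 <= Q.
    move=> tt; have := energy _ _ (lexx t0) tt; rewrite -/M -/c.
    have c4 : 0 <= 4 * c * F t0 by rewrite !mulr_ge0// ltW.
    have := ler_wpM2l c4 (KC t0 t).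
    have Ft := F0 _ tt; have := mulr_ge0 M0 Ft.
    have : c / 2 * (t - t0) * `|T (u t) - u t| ^+ 2 <=
        c / 2 * (t - t0) * (`|T (u t) - u t| + 2 * F t) ^+ 2.
      apply: ler_wpM2l; first by rewrite mulr_ge0 ?subr_ge0.
      rewrite lerXn2r ?nnegrE ?addr_ge0 ?mulr_ge0//; lra.
    have := sqr_ge0 `|u t - p|; rewrite /Q; lra.
  have Q0 : 0 <= Q by have := Q_ge t0 (lexx _); rewrite subrr mulr0 mul0r.
  have cQ0 : 0 <= 4 * Q / c by rewrite !mulr_ge0// invr_ge0 ltW.
  (* For [t >= 2 * t0], [t - t0 >= t / 2] turns [Q_ge] into a bound [4 * Q / c] on the squared
     residual times [t]; the [+ 1] makes the constant positive. *)
  apply/eqO_exP; exists (Num.sqrt (4 * Q / c) + 1).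
    by rewrite ltr_wpDl// sqrtr_ge0.
  near=> t.
  have t2 : 2 * t0 <= t by near: t; apply: nbhs_pinfty_ge; exact: num_real.
  have tt0 : 0 < t by lra.
  rewrite normr_id ger0_norm ?invr_ge0 ?sqrtr_ge0//.
  apply: (@le_trans _ _ (Num.sqrt (4 * Q / c) * (Num.sqrt t)^-1)); last first.
    by apply: ler_wpM2r; rewrite ?invr_ge0 ?sqrtr_ge0// lerDl.
  apply: le_div_sqrt; rewrite ?sqrtr_ge0// sqr_sqrtr// ler_pdivlMr//.
  have := Q_ge t ltac:(lra).
  have : 0 <= c / 2 * (t / 2 - t0) * `|T (u t) - u t| ^+ 2.
    by rewrite !mulr_ge0 ?sqr_ge0//; lra.
  move: (`|T (u t) - u t| ^+ 2) => r; rewrite -/c; lra.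
- move=> f_zero.
  (* With no forcing, zero serves as both [F] and [K], and the energy inequality loses all its
     corrections. *)
  pose Z := fun _ : R => 0 : R.
  have Z_ac b : t0 < b -> @absolutely_continuous_on R R^o t0 b Z.
    move=> _ e e0; exists 1 => // n p' q' _ _ _.
    by rewrite big1// => i _; rewrite subrr normr0.
  have ZN : (fun x => - Z x) = Z by apply/funext => x; rewrite /Z oppr0.
  have Z_slope t : slope_le Z (- 0) t.
    move=> e e0; exists 1 => // s1 s2 le1 le2 _.
    by rewrite /Z subrr oppr0 add0r mulr_ge0 ?(ltW e0)// subr_ge0; exact: le_trans le1 le2.
  have {}energy s t : t0 <= s -> s <= t ->
      `|u t - p| ^+ 2 + c / 2 * (t - s) * `|T (u t) - u t| ^+ 2 <= `|u s - p| ^+ 2.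
    move=> ts st; have := energy Z Z _ Z_ac _ Z_ac _ s t ts st.
    rewrite /Z !mulr0 !addr0 mul0r addr0; apply=> //.
      apply: aeW => x tx.
      by rewrite f_zero ?normr0 ?ltW//; exact: Z_slope.
    by apply: aeW => x _; rewrite ZN; exact: Z_slope.
  pose S := [set `|u s - p| ^+ 2 | s in `[t0, +oo[].
  have S_lb : has_lbound S by exists 0 => _ [s _ <-]; exact: sqr_ge0.
  have S_inf : has_inf S.
    by split => //; exists (`|u t0 - p| ^+ 2), t0 => //=; rewrite in_itv/= lexx.
  have S_ge t : t0 <= t -> inf S <= `|u t - p| ^+ 2.
    by move=> tt; apply: ge_inf => //; exists t => //=; rewrite in_itv/= tt.
  apply/eqoP => e e0.
  (* Over [[t / 2, t]] the dissipation is [c / 4 * t] times the squared residual, and it is at most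
     the excess of [|u s - p|^2] over its infimum; a margin of [c * e ^+ 2 / 4] leaves exactly
     [e ^+ 2]. *)
  have d0 : 0 < c * e ^+ 2 / 4 by rewrite divr_gt0// mulr_gt0// exprn_gt0.
  have [_ [s sD <-] s_inf] := inf_adherent d0 S_inf.
  have ts : t0 <= s by move: sD; rewrite /= in_itv/= andbT.
  near=> t.
  have t2 : 2 * s <= t by near: t; apply: nbhs_pinfty_ge; exact: num_real.
  have tt0 : 0 < t by lra.
  rewrite normr_id [in leRHS]ger0_norm ?invr_ge0 ?sqrtr_ge0//.
  apply: le_div_sqrt => //; first exact: ltW.
  have h1 := energy s (t / 2) ts ltac:(lra).
  have h2 := energy (t / 2) t ltac:(lra) ltac:(lra).
  have h3 := S_ge t ltac:(lra).
  have h4 : 0 <= c / 2 * (t / 2 - s) * `|T (u (t / 2)) - u (t / 2)| ^+ 2.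
    by rewrite !mulr_ge0 ?sqr_ge0//; lra.
  rewrite -(ler_pM2l (x := c)); last exact: theta_inf.
  move: h4 h1 h2 h3 s_inf; move: (`|T (u t) - u t| ^+ 2) => r.
  move: (`|T (u (t / 2)) - u (t / 2)| ^+ 2) (`|u t - p| ^+ 2) (`|u (t / 2) - p| ^+ 2).
  move=> r2 E1 E2; lra.
Unshelve. all: by end_near. Qed.
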